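(* Let $X$ be a nonabelian simple loop, $k\ge 0$ an integer and $Y$ a loop. The normal subloops of $X^k\times Y$ are precisely the loops $M_1\times\dots\times M_k\times N$, where $M_i\in\{\{e\},X\}$ for each $i\in\{1,\dots,k\}$ and $N\unlhd Y$.
   Context: A loop is an algebra $(X,\cdot,\backslash,/,e)$ satisfying $x(x\backslash y)=y=x\backslash(xy)$, $(x/y)y=x=(xy)/y$ and $ex=xe=x$. A normal subloop ($N\unlhd Y$) is the kernel of a loop homomorphism. A loop is abelian if it is an abelian group, and nonabelian otherwise (so a nonabelian loop may be commutative). A loop $X$ is simple if its only normal subloops are $\{e\}$ and $X$. *)

(* Defs.v *)
From HB Require Import structures.
From mathcomp Require Import all_boot.
From mathcomp Require Import classical_sets.

Set Implicit Arguments.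
Unset Strict Implicit.
Unset Printing Implicit Defensive.

Local Open Scope classical_set_scope.
Local Open Scope group_scope.

(* No choiceType is required, so the carrier is an arbitrary type.
   [ldiv x y] is x \ y and [rdiv x y] is x / y.  The notation [x / y] of
   [group_scope] stands for x * y^-1 and is not used here. *)
HB.mixin Record BaseUMagma_isLoop X of BaseUMagma X := {
  ldiv : X -> X -> X;
  rdiv : X -> X -> X;
  mul_ldiv : forall x y : X, x * ldiv x y = y;
  ldiv_mul : forall x y : X, ldiv x (x * y) = y;
  rdiv_mul : forall x y : X, rdiv x y * y = x;
  mul_rdiv : forall x y : X, rdiv (x * y) y = x;
  loop_mul1 : forall x : X, 1 * x = x;
  loop_mulr1 : forall x : X, x * 1 = x
}.

#[short(type="loopType")]
HB.structure Definition Loop := {X of BaseUMagma_isLoop X & BaseUMagma X}.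

Section ProdLoop.
Variables X Y : loopType.

Definition pair_ldiv (p q : X * Y) : X * Y := (ldiv p.1 q.1, ldiv p.2 q.2).
Definition pair_rdiv (p q : X * Y) : X * Y := (rdiv p.1 q.1, rdiv p.2 q.2).

Fact pair_mul_ldiv (p q : X * Y) : p * pair_ldiv p q = q.
Proof. by case: p q => [a b] [c d]; congr pair; apply: mul_ldiv. Qed.
Fact pair_ldiv_mul (p q : X * Y) : pair_ldiv p (p * q) = q.
Proof. by case: p q => [a b] [c d]; congr pair; apply: ldiv_mul. Qed.
Fact pair_rdiv_mul (p q : X * Y) : pair_rdiv p q * q = p.
Proof. by case: p q => [a b] [c d]; congr pair; apply: rdiv_mul. Qed.
Fact pair_mul_rdiv (p q : X * Y) : pair_rdiv (p * q) q = p.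
Proof. by case: p q => [a b] [c d]; congr pair; apply: mul_rdiv. Qed.
Fact pair_loop_mul1 (p : X * Y) : 1 * p = p.
Proof. by case: p => [a b]; congr pair; apply: loop_mul1. Qed.
Fact pair_loop_mulr1 (p : X * Y) : p * 1 = p.
Proof. by case: p => [a b]; congr pair; apply: loop_mulr1. Qed.

HB.instance Definition _ := BaseUMagma_isLoop.Build (X * Y)%type
  pair_mul_ldiv pair_ldiv_mul pair_rdiv_mul pair_mul_rdiv
  pair_loop_mul1 pair_loop_mulr1.
End ProdLoop.

Section FfunLoop.
Variables (I : finType) (X : loopType).
Implicit Types f g : {ffun I -> X}.

Definition ffun_ldiv f g : {ffun I -> X} := [ffun i => ldiv (f i) (g i)].
Definition ffun_rdiv f g : {ffun I -> X} := [ffun i => rdiv (f i) (g i)].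

Fact ffun_mul_ldiv f g : f * ffun_ldiv f g = g.
Proof. by apply/ffunP => i; rewrite !ffunE mul_ldiv. Qed.
Fact ffun_ldiv_mul f g : ffun_ldiv f (f * g) = g.
Proof. by apply/ffunP => i; rewrite !ffunE ldiv_mul. Qed.
Fact ffun_rdiv_mul f g : ffun_rdiv f g * g = f.
Proof. by apply/ffunP => i; rewrite !ffunE rdiv_mul. Qed.
Fact ffun_mul_rdiv f g : ffun_rdiv (f * g) g = f.
Proof. by apply/ffunP => i; rewrite !ffunE mul_rdiv. Qed.
Fact ffun_loop_mul1 f : 1 * f = f.
Proof. by apply/ffunP => i; rewrite !ffunE loop_mul1. Qed.
Fact ffun_loop_mulr1 f : f * 1 = f.
Proof. by apply/ffunP => i; rewrite !ffunE loop_mulr1. Qed.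

HB.instance Definition _ := BaseUMagma_isLoop.Build {ffun I -> X}
  ffun_mul_ldiv ffun_ldiv_mul ffun_rdiv_mul ffun_mul_rdiv
  ffun_loop_mul1 ffun_loop_mulr1.
End FfunLoop.

Definition loop_hom (X Z : loopType) (f : X -> Z) : Prop :=
  [/\ {morph f : x y / x * y},
      {morph f : x y / ldiv x y},
      {morph f : x y / rdiv x y} &
      f 1 = 1].

(* Subloops are identified with their underlying sets. *)
Definition loop_ker (X Z : loopType) (f : X -> Z) : set X := [set x | f x = 1].

Definition normal_subloop (X : loopType) (N : set X) : Prop :=
  exists (Z : loopType) (f : X -> Z), loop_hom f /\ N = loop_ker f.

(* The unit laws, also part of the group axioms, hold in every loop. *)
Definition abelian_loop (X : loopType) : Prop :=
  [/\ associative (@mul X),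
      commutative (@mul X) &
      forall x : X, exists y : X, y * x = 1 /\ x * y = 1].

Definition simple_loop (X : loopType) : Prop :=
  forall N : set X, normal_subloop N -> N = [set 1] \/ N = setT.

(* Main.v *)
Require Import Defs.
From HB Require Import structures.
From mathcomp Require Import all_boot.
From mathcomp Require Import boolp classical_sets.

(** Let [S] be the kernel of [f].  For each [i], the preimage of [S] in the
    [i]-th factor [X] is [1] or [X] by simplicity.  If it is [1], then [f] is
    injective on every coset of the [i]-th factor.  Multiplying [s] in [S] with
    elements of that factor in different orders gives elements with the same
    image under [f] which differ in coordinate [i] only, so [s i] commutes and
    associates with everything.  The center of [X] is a normal subloop, hence
    trivial as [X] is simple and nonabelian, and [s i = 1].  So [S] contains
    each factor on which it projects nontrivially. *)

Set Implicit Arguments.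
Unset Strict Implicit.
Unset Printing Implicit Defensive.

Local Open Scope classical_set_scope.
Local Open Scope group_scope.

(** * Cancellation, homomorphisms and preimages *)

Section LoopTheory.
Variable X : loopType.
Implicit Types x y z : X.

Lemma loop_mulI x : injective (mul x).
Proof. by move=> y z e; rewrite -(ldiv_mul x y) e ldiv_mul. Qed.

Lemma loop_mulIr x : injective (mul^~ x).
Proof. by move=> y z /= e; rewrite -(mul_rdiv y x) e mul_rdiv. Qed.

End LoopTheory.

(** Each quotient, and the unit, is the unique solution of a multiplicative equation, so
    cancellation in [Z] forces [f] to preserve it. *)
Lemma mul_loop_hom (X Z : loopType) (f : X -> Z) :
  {morph f : x y / x * y} -> loop_hom f.
Proof.
move=> fM; split=> // [x y|x y|].
- by apply: (@loop_mulI _ (f x)); rewrite -fM !mul_ldiv.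
- by apply: (@loop_mulIr _ (f y)); rewrite /= -fM !rdiv_mul.
- by apply: (@loop_mulI _ (f 1)); rewrite -fM !loop_mulr1.
Qed.

Lemma normal_subloop_preimage (X L : loopType) (j : X -> L) (S : set L) :
  {morph j : x y / x * y} -> normal_subloop S -> normal_subloop (j @^-1` S).
Proof.
move=> jM [Z [f [[fM _ _ _] ->]]]; exists Z, (f \o j); split=> //.
by apply: mul_loop_hom => x y /=; rewrite jM fM.
Qed.

(* On an infinite loop, compatibility with multiplication alone does not make
   the quotient a loop; the cancellation laws are needed as well. *)
Record loop_congruence (X : loopType) := LoopCongruence {
  cong_rel :> X -> X -> Prop;
  cong_refl : forall x, cong_rel x x;
  cong_sym : forall x y, cong_rel x y -> cong_rel y x;
  cong_trans : forall x y z, cong_rel x y -> cong_rel y z -> cong_rel x z;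
  cong_mul : forall x x' y y',
    cong_rel x x' -> cong_rel y y' -> cong_rel (x * y) (x' * y');
  cong_mulI : forall x y z, cong_rel (x * y) (x * z) -> cong_rel y z;
  cong_mulIr : forall x y z, cong_rel (y * x) (z * x) -> cong_rel y z
}.

(** * The quotient of a loop by a congruence *)

Section Quotient.
Variables (X : loopType) (E : loop_congruence X).

(** Classes are taken as subsets of [X], so that extensionality turns related elements into equal
    classes; operations go through chosen representatives. *)
Definition loop_quot := {C : set X | exists x, C = E x}.

Definition quot_class (x : X) : loop_quot :=
  exist _ (E x) (ex_intro _ x erefl).
Definition quot_repr (C : loop_quot) : X := projT1 (cid (proj2_sig C)).

Lemma quot_classP x y : quot_class x = quot_class y <-> E x y.
Proof.
split=> [[->]|xy]; first exact: cong_refl.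
rewrite /quot_class; apply: eq_exist; apply: funext => z.
apply: propext; split=> h.
- exact: cong_trans (cong_sym xy) h.
- exact: cong_trans xy h.
Qed.

Lemma quot_reprK C : quot_class (quot_repr C) = C.
Proof.
rewrite /quot_repr; case: (cid _) => x /=.
by case: C => C CE /= eC; apply: eq_exist.
Qed.

Lemma quot_repr_class x : E (quot_repr (quot_class x)) x.
Proof. by apply/quot_classP; rewrite quot_reprK. Qed.

Definition quot_mul C D := quot_class (quot_repr C * quot_repr D).
Definition quot_ldiv C D := quot_class (ldiv (quot_repr C) (quot_repr D)).
Definition quot_rdiv C D := quot_class (rdiv (quot_repr C) (quot_repr D)).

Lemma quot_classM x y :
  quot_class (x * y) = quot_mul (quot_class x) (quot_class y).
Proof. by apply/quot_classP/cong_mul; apply/cong_sym/quot_repr_class. Qed.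

Fact quot_mul_ldiv C D : quot_mul C (quot_ldiv C D) = D.
Proof. by rewrite -{1}(quot_reprK C) -quot_classM mul_ldiv quot_reprK. Qed.

Fact quot_ldiv_mul C D : quot_ldiv C (quot_mul C D) = D.
Proof.
rewrite -[RHS]quot_reprK; apply/quot_classP.
by apply: (@cong_mulI _ _ (quot_repr C)); rewrite mul_ldiv; exact: quot_repr_class.
Qed.

Fact quot_rdiv_mul C D : quot_mul (quot_rdiv C D) D = C.
Proof. by rewrite -{2}(quot_reprK D) -quot_classM rdiv_mul quot_reprK. Qed.

Fact quot_mul_rdiv C D : quot_rdiv (quot_mul C D) D = C.
Proof.
rewrite -[RHS]quot_reprK; apply/quot_classP.
by apply: (@cong_mulIr _ _ (quot_repr D)); rewrite rdiv_mul; exact: quot_repr_class.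
Qed.

Fact quot_mul1 C : quot_mul (quot_class 1) C = C.
Proof. by rewrite -(quot_reprK C) -quot_classM loop_mul1. Qed.

Fact quot_mulr1 C : quot_mul C (quot_class 1) = C.
Proof. by rewrite -(quot_reprK C) -quot_classM loop_mulr1. Qed.

HB.instance Definition _ := hasMul.Build loop_quot quot_mul.
HB.instance Definition _ := hasOne.Build loop_quot (quot_class 1).
HB.instance Definition _ := BaseUMagma_isLoop.Build loop_quot
  quot_mul_ldiv quot_ldiv_mul quot_rdiv_mul quot_mul_rdiv quot_mul1 quot_mulr1.

Lemma normal_subloop_cong : normal_subloop [set x | E x 1].
Proof.
exists loop_quot, quot_class; split.
  by apply: mul_loop_hom => x y; rewrite quot_classM.
by apply/seteqP; split=> x /= /quot_classP.
Qed.

End Quotient.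

(** * The center is a normal subloop *)

Section Center.
Variable X : loopType.
Implicit Types x y z w : X.

(** This is the usual center: with commutativity, the other two laws give associativity for [z] in
    the middle and right positions as well. *)
Definition central z : Prop :=
  [/\ forall x, z * x = x * z,
      forall x y, z * (x * y) = z * x * y &
      forall x y, z * (x * y) = x * (z * y)].

Lemma central1 : central 1.
Proof. by split=> *; rewrite !(loop_mul1, loop_mulr1). Qed.

Lemma centralM z w : central z -> central w -> central (z * w).
Proof.
move=> [zC zA zL] [wC wA wL]; split=> [x|x y|x y].
- by rewrite -zA wC zL.
- by rewrite -!zA wA zA.
- by rewrite -!zA wL zL.
Qed.

Lemma central_inv z : central z -> central (ldiv z 1).
Proof.
move=> [zC zA zL].
(* Multiplying a law for [ldiv z 1] by [z] on the left thus removes the inverse, once [z] is moved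
   inward by its own centrality. *)
have zK x : z * (ldiv z 1 * x) = x by rewrite zA mul_ldiv loop_mul1.
split=> [x|x y|x y]; apply: (@loop_mulI _ z).
- by rewrite zK zL mul_ldiv loop_mulr1.
- by rewrite zK zA zK.
- by rewrite zK zL zK.
Qed.

(** The classes are the cosets of the center, and the class of [1] is the center itself. *)
Definition central_rel x y : Prop := exists2 z, central z & x = z * y.

Fact central_rel_refl x : central_rel x x.
Proof. by exists 1; rewrite ?loop_mul1 //; exact: central1. Qed.

Fact central_rel_sym x y : central_rel x y -> central_rel y x.
Proof.
move=> [z zZ ->]; exists (ldiv z 1); first exact: central_inv.
have [_ uA _] := central_inv zZ; have [zC _ _] := zZ.
by rewrite uA -zC mul_ldiv loop_mul1.
Qed.

Fact central_rel_trans x y w :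
  central_rel x y -> central_rel y w -> central_rel x w.
Proof.
move=> [u uZ ->] [v vZ ->]; exists (u * v); first exact: centralM.
by case: uZ => _ ->.
Qed.

Fact central_rel_mul x x' y y' :
  central_rel x x' -> central_rel y y' -> central_rel (x * y) (x' * y').
Proof.
move=> [u uZ ->] [v vZ ->]; exists (u * v); first exact: centralM.
have [_ uA _] := uZ; have [_ _ vL] := vZ.
by rewrite -!uA vL.
Qed.

Fact central_rel_mulI x y w : central_rel (x * y) (x * w) -> central_rel y w.
Proof.
by move=> [z zZ e]; exists z => //; case: zZ e => _ _ -> /loop_mulI.
Qed.

Fact central_rel_mulIr x y w : central_rel (y * x) (w * x) -> central_rel y w.
Proof.
move=> [z zZ e]; exists z => //; case: zZ e => _ -> _ e.
exact: loop_mulIr e.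
Qed.

Definition central_congruence := LoopCongruence central_rel_refl
  central_rel_sym central_rel_trans central_rel_mul central_rel_mulI
  central_rel_mulIr.

Lemma normal_subloop_center : normal_subloop [set x | central x].
Proof.
have -> : [set x | central x] = [set x | central_congruence x 1].
  apply/seteqP; split=> [x xZ|x [z zZ ->]] /=; last by rewrite loop_mulr1.
  by exists x; rewrite ?loop_mulr1.
exact: normal_subloop_cong.
Qed.

Lemma simple_center_trivial x :
  ~ abelian_loop X -> simple_loop X -> central x -> x = 1.
Proof.
move=> nab simpX xZ.
have [e|e] := simpX _ normal_subloop_center.
  by have : [set y | central y] x by []; rewrite e.
have allZ y : central y by have : [set: X] y by []; rewrite -e.
case: nab; split=> [y z w|y z|y].
- by have [_ -> _] := allZ y.
- by have [-> _ _] := allZ y.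
- by exists (ldiv y 1); have [<- _ _] := allZ y; rewrite mul_ldiv.
Qed.

End Center.

(** * Coordinates and factors of the product [L] *)

Section PowerProduct.
Variables (X : loopType) (k : nat) (Y : loopType).
Local Notation L := ({ffun 'I_k -> X} * Y)%type.
Implicit Types (s : L) (i : 'I_k) (x y : X).

Definition set_coord i x s : L :=
  ([ffun j => if j == i then x else s.1 j], s.2).

Definition inj_coord i x : L := set_coord i x 1.

Definition inj_last (y : Y) : L := (1, y).

Lemma mul_set_coord i x y s t :
  set_coord i x s * set_coord i y t = set_coord i (x * y) (s * t).
Proof. by congr pair; apply/ffunP => j; rewrite !ffunE; case: ifP. Qed.

Lemma set_coord_id i s : set_coord i (s.1 i) s = s.
Proof.
by case: s => g y; congr pair; apply/ffunP => j; rewrite ffunE; case: eqP => [->|].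
Qed.

Lemma inj_coordM i : {morph inj_coord i : x y / x * y}.
Proof. by move=> x y; rewrite /inj_coord mul_set_coord loop_mul1. Qed.

Lemma inj_lastM : {morph inj_last : y z / y * z}.
Proof. by move=> y z; congr pair; rewrite loop_mul1. Qed.

Lemma mul_inj_coord i x s : s * inj_coord i x = set_coord i (s.1 i * x) s.
Proof. by rewrite -{1}(set_coord_id i s) mul_set_coord loop_mulr1. Qed.

Lemma inj_coord_mul i x s : inj_coord i x * s = set_coord i (x * s.1 i) s.
Proof. by rewrite -{1}(set_coord_id i s) mul_set_coord loop_mul1. Qed.

(** * Kernels of homomorphisms on [L] *)

Section Kernel.
Variables (Z : loopType) (f : L -> Z).
Hypothesis fhom : loop_hom f.

Let fM : {morph f : x y / x * y}. Proof. by case: fhom. Qed.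

Lemma set_coord_inj_mod i :
  (forall x, f (inj_coord i x) = 1 -> x = 1) ->
  forall s x y, f (set_coord i x s) = f (set_coord i y s) -> x = y.
Proof.
move=> triv s x y.
(* The right factor does not depend on [z], so its image cancels and only the [i]-th factor
   remains. *)
have dec z : set_coord i z s = inj_coord i z * set_coord i 1 s.
  by rewrite mul_set_coord loop_mulr1 loop_mul1.
rewrite (dec x) (dec y) !fM => /loop_mulIr fxy.
suff e : ldiv x y = 1 by rewrite -(mul_ldiv x y) e loop_mulr1.
apply: triv; apply: (@loop_mulI _ (f (inj_coord i x))).
by rewrite -fM -inj_coordM mul_ldiv loop_mulr1.
Qed.

Lemma kernel_coord_central i s :
  (forall x, f (inj_coord i x) = 1 -> x = 1) -> f s = 1 -> central (s.1 i).
Proof.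
move=> /set_coord_inj_mod inj fs1.
have coordE z : (set_coord i z s).1 i = z by rewrite ffunE eqxx.
have setE z w : set_coord i z (set_coord i w s) = set_coord i z s.
  by rewrite /set_coord; congr pair; apply/ffunP => j; rewrite !ffunE; case: eqP.
(* Under [f], multiplying by [s] on either side has no effect. *)
have sl z : f (set_coord i (s.1 i * z) s) = f (inj_coord i z).
  by rewrite -mul_inj_coord fM fs1 loop_mul1.
have sr z : f (set_coord i (z * s.1 i) s) = f (inj_coord i z).
  by rewrite -inj_coord_mul fM fs1 loop_mulr1.
split=> [x|x y|x y]; apply: (inj s).
- by rewrite sl sr.
(* The image of [x * y] splits into two factors, and [s] is absorbed into the first; the next case
   absorbs it into the second. *)
- rewrite sl inj_coordM fM -(sl x) -fM mul_inj_coord coordE.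
  by rewrite setE.
- rewrite sl inj_coordM fM -(sl y) -fM inj_coord_mul coordE.
  by rewrite setE.
Qed.

(** The tuple [g] is built from [1] by inserting one coordinate at a time, each insertion being a
    multiplication by a kernel element. *)
Lemma kernel_of_coords (g : {ffun 'I_k -> X}) :
  (forall i, f (inj_coord i (g i)) = 1) -> f (g, 1) = 1.
Proof.
move=> fg.
have H (r : seq 'I_k) : f ([ffun i => if i \in r then g i else 1], 1) = 1.
  elim: r => [|i r IH].
    by case: fhom => _ _ _ <-; congr (f (_, _)); apply/ffunP => j; rewrite !ffunE.
  have [ir|ir] := boolP (i \in r).
    rewrite -[RHS]IH; congr (f (_, _)); apply/ffunP => j.
    by rewrite !ffunE inE; case: eqP => [->|]; rewrite ?ir.
  (* Since [i] is not in [r], the partial tuple still has [1] there, and the product puts [g i] in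
     its place. *)
  rewrite -[RHS]loop_mul1 -{1}(fg i) -{1}IH -fM inj_coord_mul.
  congr (f (_, _)); apply/ffunP => j; rewrite !ffunE inE (negbTE ir) loop_mulr1.
  by case: eqP => [->|_]; rewrite ?ffunE.
rewrite -[RHS](H (enum 'I_k)); congr (f (_, _)).
by apply/ffunP => j; rewrite ffunE mem_enum.
Qed.

End Kernel.

Lemma normal_subloop_product (M : 'I_k -> set X) (N : set Y) :
  (forall i, M i = [set 1] \/ M i = setT) -> normal_subloop N ->
  normal_subloop ([set g : {ffun 'I_k -> X} | forall i, M i (g i)] `*` N).
Proof.
move=> M1T [W [h [[hM _ _ _] ->]]].
(* This map keeps the coordinates with [M i] trivial, collapses the others to [1], and applies [h]
   on [Y]; its kernel is the required product. *)
pose f (s : L) : {ffun 'I_k -> X} * W :=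
  ([ffun i => if `[< M i = [set 1] >] then s.1 i else 1], h s.2).
exists ({ffun 'I_k -> X} * W)%type, f; split.
  apply: mul_loop_hom => s t; congr pair; last exact: hM.
  by apply/ffunP => i; rewrite !ffunE; case: ifP; rewrite ?loop_mul1.
apply/seteqP; split=> [[g y] /= [Mg hy]|[g y] /= [/ffunP g1 hy]].
  congr pair => //; apply/ffunP => i; rewrite !ffunE.
  by case: asboolP => // Mi; have := Mg i; rewrite Mi.
split=> // i; have [Mi|Mi] := M1T i; rewrite Mi //=.
by have := g1 i; rewrite !ffunE asboolT.
Qed.

End PowerProduct.

Theorem lemma4p1 (X : loopType) (k : nat) (Y : loopType)
    (X_nonabelian : ~ abelian_loop X) (X_simple : simple_loop X)
    (S : set ({ffun 'I_k -> X} * Y)) :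
  normal_subloop S <->
  exists (M : 'I_k -> set X) (N : set Y),
    [/\ forall i, M i = [set 1] \/ M i = setT,
        normal_subloop N &
        S = [set f : {ffun 'I_k -> X} | forall i, M i (f i)] `*` N].
Proof.
split=> [nS|[M [N [M1T nN ->]]]]; last exact: normal_subloop_product.
have nM i := normal_subloop_preimage (@inj_coordM X k Y i) nS.
have nN := normal_subloop_preimage (@inj_lastM X k Y) nS.
(* The factors can only be the traces of [S] on the embedded copies of [X] and [Y]. *)
exists (fun i => inj_coord Y i @^-1` S), (@inj_last X k Y @^-1` S).
split=> // [i|]; first exact: X_simple.
case: nS nM => Z [f [fhom ->]] nM {nN}; have [fM _ _ _] := fhom.
(* Once all coordinates of [g] lie in the traces, [f (g, 1) = 1], so membership of [(g, y)] depends
   on [y] alone. *)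
have splitE g y : f (g, y) = f (g, 1) * f (inj_last X k y).
  by rewrite -fM; congr (f (_, _)); rewrite ?loop_mulr1 ?loop_mul1.
apply/seteqP; split=> [[g y] /= fgy|[g y] /= [Mg Ny]]; rewrite /loop_ker /=.
  have Mg i : f (inj_coord Y i (g i)) = 1.
    have [e|e] := X_simple _ (nM i).
      have triv x : f (inj_coord Y i x) = 1 -> x = 1.
        move=> fx; have : (inj_coord Y i @^-1` loop_ker f) x by [].
        by rewrite e.
      have gZ := kernel_coord_central fhom triv fgy.
      have /= -> := simple_center_trivial X_nonabelian X_simple gZ.
      by have : [set 1] (1 : X) by []; rewrite -e.
    by have : [set: X] (g i) by []; rewrite -e.
  split=> //=.
  by move: fgy; rewrite /loop_ker /= splitE (kernel_of_coords fhom Mg) loop_mul1.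
by rewrite splitE (kernel_of_coords fhom Mg) loop_mul1.
Qed.
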